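(* Let $\mu,\nu\in\mathcal{S}^n$ be two probability measures on $\{0,\dots,n\}$. Then $$\|\mu-\nu\|_{\mathrm{TV}}=\|\mu-\nu\|_{\ell^1}\le 2\tanh\frac{\mathcal{H}(\mu,\nu)}{4}.$$ Equivalently, $$\sup_{A\subseteq\{0,\dots,n\}}\Big|\sum_{i\in A}(\mu^i-\nu^i)\Big|\le\mathcal{T}(\mu,\nu).$$
   Context: $\mathcal{S}^n=\{x\in\mathbb{R}_+^{n+1}:\sum_{i=0}^nx^i=1\}$. The total variation norm uses the convention $\|\mu-\nu\|_{\mathrm{TV}}=2\sup_A|\mu(A)-\nu(A)|$, and $\|\mu-\nu\|_{\ell^1}=\sum_{i=0}^n|\mu^i-\nu^i|$. The Hilbert projective metric on $\mathcal{S}^n$ is $\mathcal{H}(\mu,\nu)=\log\frac{\max_{i:\nu^i>0}\mu^i/\nu^i}{\min_{j:\nu^j>0}\mu^j/\nu^j}$ if $\mu$ and $\nu$ have the same support, and $\mathcal{H}(\mu,\nu)=\infty$ otherwise. $\mathcal{T}(\mu,\nu)=\tanh(\mathcal{H}(\mu,\nu)/4)$, with $\tanh(\infty)=1$. *)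

(* Defs.v *)
From HB Require Import structures.
From mathcomp Require Import all_boot all_order all_algebra.
From mathcomp Require Import all_classical all_reals all_analysis.
Set Implicit Arguments.
Unset Strict Implicit.
Unset Printing Implicit Defensive.
Import Order.TTheory GRing.Theory Num.Theory.
Import numFieldNormedType.Exports.
Local Open Scope classical_set_scope.
Local Open Scope ring_scope.

Definition simplex (R : realType) (n : nat) : set 'rV[R]_n.+1 :=
  [set mu : 'rV[R]_n.+1 | (forall i, 0 <= mu 0 i) /\ \sum_i mu 0 i = 1].
Arguments simplex : clear implicits.

Definition meas (R : realType) (n : nat) (mu : 'rV[R]_n.+1)
    (A : {set 'I_n.+1}) : R :=
  \sum_(i in A) mu 0 i.

(* Normalised with a factor 2, so that the distance between mutually singular
   probability measures is 2. *)
Definition tv_dist (R : realType) (n : nat) (mu nu : 'rV[R]_n.+1) : R :=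
  2 * sup (range (fun A : {set 'I_n.+1} => `|meas mu A - meas nu A|)).

Definition l1_dist (R : realType) (n : nat) (mu nu : 'rV[R]_n.+1) : R :=
  \sum_i `|mu 0 i - nu 0 i|.

Definition supp (R : realType) (n : nat) (mu : 'rV[R]_n.+1) : {set 'I_n.+1} :=
  [set i | mu 0 i != 0]%SET.

(* On the simplex the index set [0 < nu 0 i] is nonempty, so the defaults -oo
   and +oo are absorbed and these are a genuine maximum and minimum. *)
Definition max_ratio (R : realType) (n : nat) (mu nu : 'rV[R]_n.+1) : \bar R :=
  \big[maxe/-oo%E]_(i < n.+1 | 0 < nu 0 i) (mu 0 i / nu 0 i)%:E.

Definition min_ratio (R : realType) (n : nat) (mu nu : 'rV[R]_n.+1) : \bar R :=
  \big[mine/+oo%E]_(i < n.+1 | 0 < nu 0 i) (mu 0 i / nu 0 i)%:E.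

Definition hilbert (R : realType) (n : nat) (mu nu : 'rV[R]_n.+1) : \bar R :=
  if supp mu == supp nu then lne (max_ratio mu nu / min_ratio mu nu)%E
  else +oo%E.

Definition tanh (R : realType) (x : R) : R :=
  (expR x - expR (- x)) / (expR x + expR (- x)).

Definition tanhe (R : realType) (x : \bar R) : R :=
  match x with
  | r%:E => tanh r
  | +oo => 1%R
  | -oo => (-1)%R
  end%E.

Definition birkhoff (R : realType) (n : nat) (mu nu : 'rV[R]_n.+1) : R :=
  tanhe (hilbert mu nu / 4%:E)%E.

(* Main.v *)
(** If [mu] and [nu] have the same support and [m <= mu i / nu i <= M] on it,
then for every event [A] the numbers [p = mu A] and [r = nu A] satisfy
[p (1 - r) m <= r (1 - p) M]: the odds ratio is at most [q ^+ 2 = M / m].  Put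
[x = sqrt (p (1 - r))] and [y = sqrt (r (1 - p))].  Then [x <= q y],
[x + y <= 1] by AM-GM, and
[p - r = (x - y) (x + y) <= (q - 1) / (q + 1) (x + y) ^+ 2], where
[(q - 1) / (q + 1) = tanh (ln (M / m) / 4)].  Finally, the total variation
distance is attained at [A = {mu > nu}], where it is half the l1 distance. *)
Require Import Defs.
From HB Require Import structures.
From mathcomp Require Import all_boot all_order all_algebra.
From mathcomp Require Import all_classical all_reals all_analysis.
From mathcomp Require Import ring lra.
Set Implicit Arguments.
Unset Strict Implicit.
Unset Printing Implicit Defensive.
Import Order.TTheory GRing.Theory Num.Theory.
Import numFieldNormedType.Exports.
Local Open Scope classical_set_scope.
Local Open Scope ring_scope.

Lemma sqrt_mul_le_half_add (R : realType) (a b : R) :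
  0 <= a -> 0 <= b -> Num.sqrt (a * b) <= (a + b) / 2.
Proof.
move=> a0 b0; have ab0 : 0 <= (a + b) / 2 by lra.
rewrite -(ger0_norm ab0) -sqrtr_sqr ler_sqrt ?sqr_ge0 //.
(* After squaring, the gap between the two sides is [(a - b) ^+ 2 / 4]. *)
have := sqr_ge0 (a - b); nra.
Qed.

Lemma sub_le_of_odds_ratio (R : realType) (p r q : R) :
  0 <= p <= 1 -> 0 <= r <= 1 -> 0 < q ->
  p * (1 - r) <= q ^+ 2 * (r * (1 - p)) ->
  1 <= q -> p - r <= (q - 1) / (q + 1).
Proof.
move=> /andP[p0 p1] /andP[r0 r1] q0 odds q1.
have p1' : 0 <= 1 - p by lra.
have r1' : 0 <= 1 - r by lra.
have x0 := sqrtr_ge0 (p * (1 - r)); have y0 := sqrtr_ge0 (r * (1 - p)).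
have xy1 : Num.sqrt (p * (1 - r)) + Num.sqrt (r * (1 - p)) <= 1.
  have := sqrt_mul_le_half_add p0 r1'; have := sqrt_mul_le_half_add r0 p1'; lra.
have xqy : Num.sqrt (p * (1 - r)) <= q * Num.sqrt (r * (1 - p)).
  rewrite -[X in _ <= X * _](ger0_norm (ltW q0)) -sqrtr_sqr -sqrtrM ?sqr_ge0 //.
  by rewrite ler_sqrt // mulr_ge0 ?sqr_ge0 ?mulr_ge0.
have := sqr_sqrtr (mulr_ge0 p0 r1'); have := sqr_sqrtr (mulr_ge0 r0 p1').
move: x0 y0 xy1 xqy.
set x := Num.sqrt (p * _); set y := Num.sqrt (r * _) => x0 y0 xy1 xqy ey ex.
have -> : p - r = (x - y) * (x + y).
  by rewrite -subr_sqr ex ey; ring.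
rewrite ler_pdivlMr; last by lra.
(* Expanded, the gap between the two sides is [2 * (q * y - x)], so this is [x <= q * y] in
   disguise. *)
have h1 : (x - y) * (q + 1) <= (q - 1) * (x + y) by lra.
have h2 : (x + y) * (x + y) <= 1 by nra.
apply: (@le_trans _ _ ((q - 1) * ((x + y) * (x + y)))).
  rewrite mulrAC [leRHS]mulrA; apply: ler_wpM2r => //; lra.
by rewrite ler_piMr //; lra.
Qed.

(** With [e = expR (ln x / 4)] one has [Num.sqrt x = e ^+ 2]; multiplying numerator and denominator
    of [tanh] by [e] gives the quotient. *)
Lemma tanh_ln_div4 (R : realType) (x : R) : 0 < x ->
  tanh (ln x / 4) = (Num.sqrt x - 1) / (Num.sqrt x + 1).
Proof.
move=> x0; rewrite /tanh expRN.
have e0 := expR_gt0 (ln x / 4).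
have ex : Num.sqrt x = expR (ln x / 4) ^+ 2.
  rewrite -[in LHS](lnK x0) -expRM_natl.
  have -> : ln x = ln x / 2 + ln x / 2 by lra.
  rewrite expRD -expr2 sqrtr_sqr ger0_norm ?expR_ge0 //; congr expR; lra.
rewrite ex; move: (expR _) e0 => e e0; have := sqr_ge0 e => ?.
by field; do ?[apply/andP; split]; apply/lt0r_neq0; rewrite ?expr2; nra.
Qed.

Lemma meas_ge0 (R : realType) (n : nat) (mu : 'rV[R]_n.+1)
  (hmu : simplex R n mu) (A : {set 'I_n.+1}) : 0 <= meas mu A.
Proof. by apply: sumr_ge0 => i _; apply: hmu.1. Qed.

Lemma measC (R : realType) (n : nat) (mu : 'rV[R]_n.+1)
  (hmu : simplex R n mu) (A : {set 'I_n.+1}) :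
  meas mu (~: A)%SET = 1 - meas mu A.
Proof.
rewrite -hmu.2 (bigID (mem A)) /= addrAC subrr add0r.
by apply: eq_bigl => i; rewrite inE.
Qed.

Lemma meas_le1 (R : realType) (n : nat) (mu : 'rV[R]_n.+1)
  (A : {set 'I_n.+1}) : simplex R n mu -> meas mu A <= 1.
Proof.
by move=> h; have := meas_ge0 h (~: A)%SET; rewrite measC //; lra.
Qed.

(** Both total masses are 1, so the excess of [mu] where it is larger equals its deficit elsewhere;
    the two halves of the l1 sum agree. *)
Lemma l1_dist_meas (R : realType) (n : nat) (mu nu : 'rV[R]_n.+1) :
  simplex R n mu -> simplex R n nu ->
  l1_dist mu nu = 2 * (meas mu [set i | nu 0 i < mu 0 i]%SET
                       - meas nu [set i | nu 0 i < mu 0 i]%SET).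
Proof.
move=> hmu hnu; set P := [set i | _]%SET.
have -> : l1_dist mu nu =
    (meas mu P - meas nu P) + (meas nu (~: P)%SET - meas mu (~: P)%SET).
  rewrite /l1_dist (bigID (mem P)) /= /meas -!sumrB; congr (_ + _).
    by apply: eq_bigr => i; rewrite inE => h; rewrite gtr0_norm // subr_gt0.
  apply: eq_big => i; first by rewrite finset.in_setC.
  by rewrite !inE -leNgt => h; rewrite ler0_norm ?opprB // subr_le0.
by rewrite !measC //; ring.
Qed.

(** The differences on [A] and on its complement are opposite, so the triangle inequality on each
    side bounds the same number twice; averaging yields the half. *)
Lemma dist_meas_le_l1 (R : realType) (n : nat) (mu nu : 'rV[R]_n.+1)
  (A : {set 'I_n.+1}) : simplex R n mu -> simplex R n nu ->
  `|meas mu A - meas nu A| <= l1_dist mu nu / 2.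
Proof.
move=> hmu hnu.
have le B : `|meas mu B - meas nu B| <= \sum_(i in B) `|mu 0 i - nu 0 i|.
  by rewrite /meas -sumrB ler_norm_sum.
have -> : l1_dist mu nu = \sum_(i in A) `|mu 0 i - nu 0 i|
                         + \sum_(i in ~: A) `|mu 0 i - nu 0 i|.
  rewrite /l1_dist (bigID (mem A)) /=; congr (_ + _).
  by apply: eq_bigl => i; rewrite inE.
have := le A; have := le (~: A)%SET; rewrite !measC //.
have -> : 1 - meas mu A - (1 - meas nu A) = - (meas mu A - meas nu A) by ring.
rewrite normrN; lra.
Qed.

Lemma tv_distE (R : realType) (n : nat) (mu nu : 'rV[R]_n.+1) :
  simplex R n mu -> simplex R n nu -> tv_dist mu nu = l1_dist mu nu.
Proof.
move=> hmu hnu; rewrite /tv_dist.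
set f := (fun A : {set 'I_n.+1} => _).
have fle A : f A <= l1_dist mu nu / 2 by apply: dist_meas_le_l1.
have ub : ubound (range f) (l1_dist mu nu / 2) by move=> _ [A _ <-].
suff -> : sup (range f) = l1_dist mu nu / 2 by field.
apply/eqP; rewrite eq_le; apply/andP; split.
  by apply: ge_sup => //; exists (f finset.set0); exists finset.set0.
pose P := [set i | nu 0 i < mu 0 i]%SET.
apply: (@le_trans _ _ (f P)).
  by rewrite /f l1_dist_meas // mulrC mulKf ?pnatr_eq0 // ler_norm.
by apply: ub_le_sup; [exists (l1_dist mu nu / 2)|exists P].
Qed.

Lemma simplex_pos (R : realType) (n : nat) (nu : 'rV[R]_n.+1) :
  simplex R n nu -> exists i, 0 < nu 0 i.
Proof.
move=> [nu0 nu1]; apply: contrapT => h.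
suff : \sum_i nu 0 i = 0 by rewrite nu1 => /eqP; rewrite oner_eq0.
apply: big1 => i _; apply/eqP; rewrite eq_le nu0 andbT leNgt.
by apply/negP => ?; apply: h; exists i.
Qed.

Lemma ratio_bounds (R : realType) (n : nat) (mu nu : 'rV[R]_n.+1) :
  simplex R n mu -> simplex R n nu -> supp mu = supp nu ->
  exists m M : R, [/\ min_ratio mu nu = m%:E, max_ratio mu nu = M%:E, 0 < m,
    m <= M & forall i, m * nu 0 i <= mu 0 i <= M * nu 0 i].
Proof.
move=> hmu hnu esupp; have [k nuk] := simplex_pos hnu.
have supE i : (mu 0 i == 0) = (nu 0 i == 0).
  by have /setP/(_ i) := esupp; rewrite !inE => /negb_inj.
have rmax i : 0 < nu 0 i -> ((mu 0 i / nu 0 i)%:E <= max_ratio mu nu)%E.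
  by move=> h; apply: (le_bigmax_cond _ (fun i => (mu 0 i / nu 0 i)%:E)).
have rmin i : 0 < nu 0 i -> (min_ratio mu nu <= (mu 0 i / nu 0 i)%:E)%E.
  by move=> h; apply: (bigmin_le_cond _ (fun i => (mu 0 i / nu 0 i)%:E)).
(* The default [+oo] is positive, and equal supports make each ratio positive. *)
have min0 : (0 < min_ratio mu nu)%E.
  apply: lt_bigmin => // i h; rewrite lte_fin divr_gt0 //.
  by rewrite lt0r hmu.1 andbT supE gt_eqF.
have maxy : (max_ratio mu nu < +oo)%E.
  by apply: bigmax_lt => // i _; rewrite ltry.
(* The ratio at [k] keeps both extrema away from their infinite defaults. *)
have mfin : min_ratio mu nu \is a fin_num.
  rewrite fin_numElt (lt_trans _ min0) ?ltNyr //=.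
  exact: le_lt_trans (rmin _ nuk) (ltry _).
have Mfin : max_ratio mu nu \is a fin_num.
  rewrite fin_numElt maxy andbT.
  exact: lt_le_trans (ltNyr _) (rmax _ nuk).
move: rmax rmin min0; rewrite -(fineK mfin) -(fineK Mfin).
move: (fine _) (fine _) => m M rmax rmin; rewrite lte_fin => m0.
exists m, M; split=> //.
  by have := le_trans (rmin _ nuk) (rmax _ nuk); rewrite lee_fin.
(* Where [nu] vanishes so does [mu], and both bounds become trivial. *)
move=> i; have := hnu.1 i; rewrite le_eqVlt => /predU1P[/esym i0|i0].
  by move/eqP: (i0); rewrite -supE => /eqP ->; rewrite i0 !mulr0 lexx.
have := rmax _ i0; have := rmin _ i0.
by rewrite !lee_fin ler_pdivlMr // ler_pdivrMr // => -> ->.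
Qed.

Lemma meas_sub_le_birkhoff (R : realType) (n : nat) (mu nu : 'rV[R]_n.+1)
  (A : {set 'I_n.+1}) : simplex R n mu -> simplex R n nu ->
  meas mu A - meas nu A <= birkhoff mu nu.
Proof.
move=> hmu hnu; rewrite /birkhoff /hilbert.
have p0 := meas_ge0 hmu A; have r0 := meas_ge0 hnu A.
have p1 := meas_le1 A hmu; have r1 := meas_le1 A hnu.
(* For different supports the right-hand side is 1, which bounds any difference of probabilities. *)
case: eqP => [esupp|_]; last first.
  by rewrite inver pnatr_eq0 /= gt0_mulye ?lte_fin ?invr_gt0 //=; lra.
have [m [M [-> -> m0 mM bnd]]] := ratio_bounds hmu hnu esupp.
have M0 := lt_le_trans m0 mM; have Mm0 : 0 < M / m by rewrite divr_gt0.
rewrite !inver pnatr_eq0 /= (gt_eqF m0) -EFinM lne_EFin // -EFinM /=.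
rewrite tanh_ln_div4 //.
have Mm1 : 1 <= M / m by rewrite ler_pdivlMr // mul1r.
have q1 : 1 <= Num.sqrt (M / m) by rewrite -[leLHS]sqrtr1 ler_wsqrtr.
apply: sub_le_of_odds_ratio; rewrite ?p0 ?r0 ?sqrtr_gt0 //.
rewrite (sqr_sqrtr (ltW Mm0)) mulrAC ler_pdivlMr //.
have pM : meas mu A <= M * meas nu A.
  by rewrite /meas mulr_sumr; apply: ler_sum => i _; case/andP: (bnd i).
(* The upper ratio bound is summed over [A], the lower one over its complement; their product is the
   odds-ratio bound. *)
have rm : m * (1 - meas nu A) <= 1 - meas mu A.
  rewrite -!measC // /meas mulr_sumr.
  by apply: ler_sum => i _; case/andP: (bnd i).
apply: (@le_trans _ _ (M * meas nu A * (m * (1 - meas nu A)))).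
  rewrite -[leLHS]mulrA (mulrC _ m); apply: ler_wpM2r => //.
  by rewrite mulr_ge0 ?subr_ge0 // ltW.
rewrite -mulrA; apply: ler_wpM2l; first exact: ltW.
exact: ler_wpM2l.
Qed.

(** Passing to the complement flips the sign of the difference, so the one-sided bound gives both
    sides. *)
Lemma dist_meas_le_birkhoff (R : realType) (n : nat) (mu nu : 'rV[R]_n.+1)
  (A : {set 'I_n.+1}) : simplex R n mu -> simplex R n nu ->
  `|meas mu A - meas nu A| <= birkhoff mu nu.
Proof.
move=> hmu hnu; rewrite ler_norml meas_sub_le_birkhoff // andbT.
have := meas_sub_le_birkhoff (~: A)%SET hmu hnu.
by rewrite !measC //; lra.
Qed.

Theorem theorem5p1 (R : realType) (n : nat) (mu nu : 'rV[R]_n.+1)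
    (hmu : simplex R n mu) (hnu : simplex R n nu) :
  [/\ tv_dist mu nu = l1_dist mu nu,
      l1_dist mu nu <= 2 * tanhe (hilbert mu nu / 4%:E)%E
    & sup (range (fun A : {set 'I_n.+1} =>
        `|\sum_(i in A) (mu 0 i - nu 0 i)|)) <= birkhoff mu nu].
Proof.
split; first exact: tv_distE.
  rewrite l1_dist_meas //; apply: ler_wpM2l => //.
  exact: meas_sub_le_birkhoff.
apply: ge_sup => [|_ [A _ <-]].
  by eexists; exists finset.set0.
by rewrite sumrB; apply: dist_meas_le_birkhoff.
Qed.
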